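(* Suppose an orbit $(s^{(t)})_{t\ge0}$ of states is eventually periodic: there are $p\ge1$ and a unit $\lambda\in\mathcal O_K^\times$ with $\sigma_r(\lambda)>0$ such that $s^{(t+p)}=\lambda\cdot s^{(t)}$ for all large $t$. Then for all large $t$ the slope clouds satisfy $\zeta^{(t+p)}=\mu\,\zeta^{(t)}$ with $$\mu:=\frac{\sigma_c(\lambda)}{\sigma_r(\lambda)},\qquad |\mu|=\sigma_r(\lambda)^{-3/2},\qquad \arg\mu=\arg\sigma_c(\lambda),$$ i.e. the cycle is a $\mu$-self-similar configuration under a fixed logarithmic spiral, whose rotation number is the argument of the unit at the complex place.
   Context: $K$ is a cubic number field of signature $(1,1)$, with real embedding $\sigma_r$ and complex embedding $\sigma_c$; $L\subset\mathcal O_K$ is an order. A state is an ordered triple $s=(u_1,u_2,u_3)$ of elements of $L$ forming a $\mathbb Q$-basis of $K$ with positive real embeddings; $\lambda\cdot s=(\lambda u_1,\lambda u_2,\lambda u_3)$. The slope of $u\in K^\times$ is $\zeta(u)=\sigma_c(u)/\sigma_r(u)$, and the slope cloud of a state is $\zeta=(\zeta(u_1),\zeta(u_2),\zeta(u_3))\in\mathbb C^3$; $\zeta^{(t)}$ is the slope cloud of $s^{(t)}$. *)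

(* Defs.v *)
From HB Require Import structures.
From mathcomp Require Import all_boot all_order all_algebra all_field.
From mathcomp Require Import all_classical all_reals all_analysis.
From mathcomp Require Export complex.
From mathcomp Require Import ring lra.

Set Implicit Arguments.
Unset Strict Implicit.
Unset Printing Implicit Defensive.

Import Order.TTheory GRing.Theory Num.Theory.
Import numFieldNormedType.Exports.

Local Open Scope classical_set_scope.
Local Open Scope complex_scope.
Local Open Scope ring_scope.

Section NumberField.
Variables (R : realType) (K : fieldExtType rat).

Definition real_embeddings : set (K -> R) :=
  [set f | exists g : {rmorphism K -> R}, f = g :> (K -> R)].

(* Embeddings into the complex numbers whose image is not contained in the
   reals; they come in pairs of complex conjugates. *)
Definition nonreal_embeddings : set (K -> R[i]) :=
  [set f | (exists g : {rmorphism K -> R[i]}, f = g :> (K -> R[i])) /\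
           exists x, complex.Im (f x) != 0].

Definition has_signature (r1 r2 : nat) : Prop :=
  (real_embeddings #= `I_r1)%card /\
  (nonreal_embeddings #= `I_(2 * r2))%card.

Definition ring_of_integers : set K :=
  [set x | integralOver (intr : int -> K) x].

Definition integer_unit : set K :=
  [set x | ring_of_integers x /\
           exists y, ring_of_integers y /\ x * y = 1].

(* An order: a subring that is a free Z-module on some Q-basis of K. *)
Definition is_order (L : set K) : Prop :=
  [/\ L 1,
      (forall x y, L x -> L y -> L (x - y)),
      (forall x y, L x -> L y -> L (x * y)) &
      exists e : (\dim {:K}).-tuple K,
        basis_of {:K} e /\
        L = [set x | exists c : 'I_(\dim {:K}) -> int,
                       x = \sum_i tnth e i *~ c i]].

(* The triple (u_1, u_2, u_3) is the row vector s; thus lambda *: s is the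
   triple (lambda u_1, lambda u_2, lambda u_3). *)
Definition is_state (L : set K) (sigma_r : K -> R) (s : 'rV[K]_3) : Prop :=
  [/\ forall i, L (s 0 i),
      basis_of {:K} [tuple s 0 i | i < 3] &
      forall i, 0 < sigma_r (s 0 i)].

Definition slope (sigma_r : K -> R) (sigma_c : K -> R[i]) (u : K) : R[i] :=
  sigma_c u / (sigma_r u)%:C.

Definition slope_cloud (sigma_r : K -> R) (sigma_c : K -> R[i])
    (s : 'rV[K]_3) : 'rV[R[i]]_3 :=
  map_mx (slope sigma_r sigma_c) s.

End NumberField.

Section ComplexPlane.
Variable R : realType.

(* Principal argument, with values in ]-pi, pi] (see carg_bounds and
   carg_polar); its value at 0 is meaningless. *)
Definition carg (z : R[i]) : R :=
  let a := acos (complex.Re z / complex.Re `|z|) in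
  if 0 <= complex.Im z then a else - a.

(* The logarithmic spiral with pole 0 through z, parametrized by tau: one unit
   of tau multiplies the modulus by rho and adds theta to the argument. *)
Definition log_spiral (rho theta : R) (z : R[i]) (tau : R) : R[i] :=
  (rho `^ tau)%:C * (cos (tau * theta) +i* sin (tau * theta)) * z.

Lemma carg_ratio (z : R[i]) : -1 <= complex.Re z / complex.Re `|z| <= 1.
Proof.
case: z => x y; rewrite normc_def /=.
have h : `|x| <= Num.sqrt (x ^+ 2 + y ^+ 2).
  by rewrite -sqrtr_sqr ler_wsqrtr // lerDl sqr_ge0.
rewrite -ler_norml normrM normfV (ger0_norm (sqrtr_ge0 _)).
have [->|n0] := eqVneq (Num.sqrt (x ^+ 2 + y ^+ 2)) 0.
  by rewrite invr0 mulr0 ler01.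
by rewrite ler_pdivrMr ?mul1r // lt0r n0 sqrtr_ge0.
Qed.

Lemma carg_bounds (z : R[i]) : z != 0 -> - pi < carg z <= pi.
Proof.
move=> z0; rewrite /carg; have h := carg_ratio z.
have a0 := acos_ge0 h; have a1 := acos_lepi h; have p0 := pi_gt0 R.
case: ifPn => [_|]; first by apply/andP; split; lra.
rewrite -ltNge => y0; apply/andP; split; last by lra.
rewrite ltrN2; apply: acos_ltpi; case/andP: h => h1 ->; rewrite andbT.
case: z z0 y0 {a0 a1} h1 => x y _; rewrite normc_def /= => y0.
set r := Num.sqrt _ => h1.
have xr : x ^+ 2 < x ^+ 2 + y ^+ 2 by rewrite ltrDl exprn_even_gt0 //= lt_eqF.
have r2 : r ^+ 2 = x ^+ 2 + y ^+ 2 by rewrite sqr_sqrtr // addr_ge0 ?sqr_ge0.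
have r0 : 0 < r by rewrite sqrtr_gt0 (le_lt_trans _ xr) ?sqr_ge0.
rewrite lt_neqAle h1 andbT; apply/eqP => e.
have : x = - r by rewrite -[LHS](divfK (lt0r_neq0 r0)) -e mulN1r.
by move=> xe; move: xr; rewrite -r2 xe sqrrN ltxx.
Qed.

Lemma carg_polar (z : R[i]) : z != 0 ->
  z = `|z| * (cos (carg z) +i* sin (carg z)).
Proof.
move=> z0; rewrite /carg; have h := carg_ratio z.
case: z z0 h => x y z0; rewrite normc_def /=.
set r := Num.sqrt _ => h.
have r2 : r ^+ 2 = x ^+ 2 + y ^+ 2 by rewrite sqr_sqrtr // addr_ge0 ?sqr_ge0.
have r0 : 0 < r.
  rewrite lt0r sqrtr_ge0 andbT -sqrf_eq0 r2 paddr_eq0 ?sqr_ge0 // !sqrf_eq0.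
  by apply: contra z0 => /andP[/eqP-> /eqP->].
have sE : Num.sqrt (1 - (x / r) ^+ 2) = `|y| / r.
  have q0 : 0 <= `|y| / r by rewrite divr_ge0 // ltW.
  rewrite -[RHS](ger0_norm q0) -[RHS]sqrtr_sqr; congr Num.sqrt.
  rewrite !expr_div_n -[1](divff (lt0r_neq0 (exprn_gt0 2 r0))) -mulrBl r2.
  by rewrite addrAC subrr add0r -normrX ger0_norm ?sqr_ge0.
rewrite (_ : `|y| = if 0 <= y then y else - y) in sE; last first.
  by case: ifPn => [/ger0_norm //|]; rewrite -ltNge => /ltr0_norm.
have ->: forall a b : R, r%:C * (a +i* b) = (r * a) +i* (r * b).
  by move=> a b; apply/eqP; rewrite eq_complex /= !mul0r subr0 addr0 !eqxx.
case: ifPn sE => _ sE; rewrite ?cosN ?sinN acosK ?in_itv //= sin_acos // sE.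
  by congr Complex; rewrite mulrC divfK ?lt0r_neq0.
by congr Complex; rewrite mulrC ?mulNr ?opprK divfK ?lt0r_neq0.
Qed.

End ComplexPlane.

(* Main.v *)
Require Import Defs.
From HB Require Import structures.
From mathcomp Require Import all_boot all_order all_algebra all_field.
From mathcomp Require Import all_classical all_reals all_analysis.
From mathcomp Require Import complex.
From mathcomp Require Import ring.

(** Slopes are multiplicative, so [s (t + p) = lambda *: s t] becomes
    multiplication of the slope cloud by the slope [mu] of [lambda]
    ([slope_cloudZ]); iterating, [k] periods multiply it by [mu ^+ k], and by
    De Moivre's formula this is the motion along a logarithmic spiral sampled at
    integer times ([log_spiral_nat]). Division by the positive real number
    [sigma_r lambda] does not change arguments ([carg_scale]), so the angle of
    the spiral is the argument of [sigma_c lambda].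

    The arithmetic content is the modulus of [mu], that is, the identity
    sigma_r(lambda) |sigma_c(lambda)|^2 = 1 ([cubic_norm_unit]). The left-hand
    side is the norm of [lambda]. It is rational ([cubic_norm_rat]): either
    [lambda] is rational, or it generates K, which has prime degree over Q, and
    the norm is up to sign the constant coefficient of the minimal polynomial.
    It is also an algebraic integer, hence an integer; the same holds for the
    inverse of [lambda], and positivity selects 1 among the units of Z. *)

Set Implicit Arguments.
Unset Strict Implicit.
Unset Printing Implicit Defensive.

Import Order.TTheory GRing.Theory Num.Theory.
Import numFieldNormedType.Exports.

Local Open Scope classical_set_scope.
Local Open Scope complex_scope.
Local Open Scope ring_scope.

(** * Rational integers and rational generators *)

(** Being a root of a monic integer polynomial does not depend on the field in
    which the rational number is seen, so the known fact that rational algebraic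
    integers of [algC] are integers applies. *)
Lemma rat_integral_int (F : numFieldType) (c : rat) :
  integralOver (intr : int -> F) (ratr c) -> c \is a Num.int.
Proof.
case=> q mq; rewrite (eq_map_poly (g := ratr \o intr)); last first.
  by move=> m /=; rewrite ratr_int.
rewrite map_poly_comp fmorph_root => rq.
rewrite -Cint_rat; apply: Cint_rat_Aint; first exact: Crat_rat.
apply: (@root_monic_Aint (map_poly ratr (map_poly intr q))).
- by rewrite fmorph_root; exact: rq.
- by rewrite !monic_map.
by apply/polyOverP => i; rewrite !coef_map /= ratr_int intr_int.
Qed.

Lemma horner_rat_embedding (K : fieldExtType rat) (F : unitRingType)
    (f : {rmorphism K -> F}) (q : {poly rat}) (x : K) :
  f (map_poly (in_alg K) q).[x] = (map_poly ratr q).[f x].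
Proof.
rewrite -horner_map -map_poly_comp; congr _.[_].
by apply: eq_map_poly => c; exact: (fmorph_eq_rat (f \o in_alg K)).
Qed.

(** The degree of Q(x) divides the prime degree of K, so there is no field
    strictly between Q and K. *)
Lemma adjoin_degree_prime (K : fieldExtType rat) (x : K) :
  prime (\dim {:K}) -> x \notin 1%VS -> adjoin_degree 1%AS x = \dim {:K}.
Proof.
move=> pK x1; have := dim_Fadjoin 1%AS x; rewrite dimv1 muln1 => dE.
have x2 : adjoin_degree 1%AS x != 1%N by rewrite adjoin_deg_eq1.
by apply/(prime_nt_dvdP pK x2); rewrite -dE field_dimS ?subvf.
Qed.

Lemma rat_generator (K : fieldExtType rat) (x y : K) :
  prime (\dim {:K}) -> x \notin 1%VS ->
  exists q : {poly rat}, y = (map_poly (in_alg K) q).[x].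
Proof.
move=> pK x1; apply/Fadjoin1_polyP.
suff -> : <<1; x>>%VS = fullv by exact: memvf.
apply/eqP; rewrite eqEdim subvf /=.
by rewrite dim_Fadjoin adjoin_degree_prime // dimv1 muln1.
Qed.

(** * The norm of a complex cubic field *)

Section CubicNorm.
Variables (R : realType) (K : fieldExtType rat).
Variables (sigma_r : {rmorphism K -> R}) (sigma_c : {rmorphism K -> R[i]}).
Hypothesis dimK : \dim {:K} = 3%N.
Hypothesis sigma_cP : exists x, complex.Im (sigma_c x) != 0.

(** The field norm, as the product over the real embedding and the two conjugate
    nonreal ones. *)
Definition cubic_norm (x : K) : R[i] :=
  (sigma_r x)%:C * (sigma_c x * conjc (sigma_c x)).

(** If [sigma_c x] were real, then [sigma_c] would map all of K = Q(x) into the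
    reals. *)
Lemma nonreal_generator x : x \notin 1%VS -> conjc (sigma_c x) != sigma_c x.
Proof.
have [y yP] := sigma_cP; have pK : prime (\dim {:K}) by rewrite dimK.
move=> x1; apply: contra yP => /eqP xc.
have [q yE] := rat_generator y pK x1.
have cy : conjc (sigma_c y) = sigma_c y.
  rewrite yE -[LHS]/((@conjc R \o sigma_c : {rmorphism K -> R[i]}) _).
  by rewrite !horner_rat_embedding /= xc.
(* Equality of the imaginary parts reads - b = b, so b + b = 0. *)
case: (sigma_c y) cy => a b [] /= /eqP; rewrite eq_sym -subr_eq0 opprK -mulr2n.
by rewrite mulrn_eq0.
Qed.

(** For x outside Q, the minimal polynomial of x has degree three, and the three
    images of x are distinct roots of it; hence the norm is minus its constant
    coefficient. They are distinct because [sigma_c x] is not real. *)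
Lemma cubic_norm_rat x : exists c : rat, cubic_norm x = ratr c.
Proof.
have rE (F : unitRingType) (f : {rmorphism K -> F}) c : f (c%:A) = ratr c.
  exact: (fmorph_eq_rat (f \o in_alg K)).
have [/vlineP[c ->]|x1] := boolP (x \in 1%VS).
  exists (c * (c * c)).
  have -> : cubic_norm c%:A = ratr c * (ratr c * ratr c).
    congr (_ * (_ * _)); first exact: (rE _ (real_complex R \o sigma_r)).
      exact: (rE _ sigma_c).
    exact: (rE _ (@conjc R \o sigma_c)).
  by rewrite !rmorphM.
have pK : prime (\dim {:K}) by rewrite dimK.
have [q qE] := polyOver1P (minPolyOver 1%AS x).
pose P : {poly R[i]} := map_poly ratr q.
have rootP (f : {rmorphism K -> R[i]}) : root P (f x).
  by rewrite /root -horner_rat_embedding -qE minPolyxx rmorph0.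
have sP : size P = 4.
  rewrite size_map_poly -(size_map_poly (in_alg K)) -qE size_minPoly.
  by rewrite adjoin_degree_prime // dimK.
have mP : lead_coef P = 1.
  have /monicP := monic_minPoly 1%AS x.
  rewrite qE !lead_coef_map => /eqP; rewrite fmorph_eq1 => /eqP ->.
  exact: rmorph1.
pose rs := [:: (sigma_r x)%:C; sigma_c x; conjc (sigma_c x)].
have PE : P = lead_coef P *: \prod_(z <- rs) ('X - z%:P).
  apply: all_roots_prod_XsubC; first by rewrite sP.
    apply/and4P; split=> //.
    - exact: (rootP (real_complex R \o sigma_r)).
    - exact: (rootP (@conjc R \o sigma_c)).
  rewrite uniq_rootsE /= !inE negb_or andbT -!andbA.
  have cx := nonreal_generator x1.
  apply/and3P; split; rewrite 1?eq_sym //; apply: contra cx => /eqP.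
    by move=> ->; rewrite conjc_real.
  by move=> h; rewrite -[eqbRHS]conjcK h conjc_real.
exists (- q`_0).
have PE0 : P`_0 = - cubic_norm x.
  rewrite PE mP scale1r -horner_coef0 !big_cons big_nil !hornerE /cubic_norm /=.
  ring.
by rewrite rmorphN /= -[cubic_norm x]opprK -PE0 coef_map.
Qed.
End CubicNorm.

(** * Units *)

Section Units.
Variables (R : realType) (K : fieldExtType rat).
Variables (sigma_r : {rmorphism K -> R}) (sigma_c : {rmorphism K -> R[i]}).
Hypothesis dimK : \dim {:K} = 3%N.
Hypothesis sigma_cP : exists x, complex.Im (sigma_c x) != 0.
Local Notation N := (cubic_norm sigma_r sigma_c).

Lemma cubic_normM x y : N (x * y) = N x * N y.
Proof. by rewrite /cubic_norm !rmorphM /=; ring. Qed.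

Lemma cubic_norm1 : N 1 = 1.
Proof. by rewrite /cubic_norm !rmorph1 !mul1r. Qed.

(** The norm is a product of algebraic integers and it is rational. *)
Lemma cubic_norm_int x : @ring_of_integers K x ->
  exists m : int, N x = m%:~R.
Proof.
move=> xint; have [c cE] := cubic_norm_rat sigma_r dimK sigma_cP x.
have intE (f : {rmorphism K -> R[i]}) : integralOver (intr : int -> R[i]) (f x).
  have [q mq rq] := integral_rmorph f xint; exists q => //.
  rewrite -(eq_map_poly (f := f \o intr)) // => m /=; exact: rmorph_int.
have : integralOver (intr : int -> R[i]) (ratr c).
  rewrite -cE; apply: integral_mul; first exact: (intE (real_complex R \o sigma_r)).
  by apply: integral_mul; [exact: intE|exact: (intE (@conjc R \o sigma_c))].
by move=> /rat_integral_int/intrP[m cm]; exists m; rewrite cE cm ratr_int.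
Qed.

Lemma cubic_normE x : N x = (sigma_r x)%:C * `|sigma_c x| ^+ 2.
Proof. by rewrite /cubic_norm sqr_normc. Qed.

(** The norms of x and of its inverse are integers with product 1, so the norm of
    x is 1 or -1; it has the sign of [sigma_r x]. *)
Lemma cubic_norm_unit x : integer_unit x -> 0 < sigma_r x -> N x = 1.
Proof.
case=> xint [y [yint xy]] x0.
have [m mE] := cubic_norm_int xint; have [n nE] := cubic_norm_int yint.
have nm : n * m = 1.
  by apply: (@intr_inj R[i]); rewrite rmorphM /= -mE -nE -cubic_normM mulrC xy cubic_norm1.
have m0 : 0 <= m.
  by rewrite -(ler0z R[i]) -mE cubic_normE mulr_ge0 ?exprn_ge0 // ler0c ltW.
by move: m0; rewrite mE; have /orP[/eqP->|/eqP->] := intUnitRing.unitzPl nm.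
Qed.

(** By [cubic_norm_unit], the modulus of [sigma_c x] is the power -1/2 of
    [sigma_r x]; dividing by [sigma_r x] gives the exponent -3/2. *)
Lemma normc_slope_unit x : integer_unit x -> 0 < sigma_r x ->
  `|sigma_c x / (sigma_r x)%:C| = (sigma_r x `^ (- (3 / 2)))%:C.
Proof.
move=> xu a0; have := cubic_norm_unit xu a0; rewrite cubic_normE.
rewrite normf_div normc_def /=; set n := Num.sqrt _; move: (sigma_r x) a0 => a a0.
rewrite -rmorphXn -rmorphM /= normc_def /= => /complexI an.
rewrite expr0n addr0 sqrtr_sqr ger0_norm ?ltW // -fmorphV -rmorphM /=.
have n0 : 0 <= n by exact: sqrtr_ge0.
congr _%:C.
have -> : n = (a `^ 2^-1)^-1.
  rewrite powR12_sqrt ?ltW // -sqrtrV ?ltW //.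
  rewrite -[n]ger0_norm // -sqrtr_sqr; congr Num.sqrt.
  by apply: (mulfI (lt0r_neq0 a0)); rewrite an divff // lt0r_neq0.
have -> : 3 / 2 = 1 + 2^-1 :> R by field.
rewrite powRN powRD ?powRr1 ?ltW //; last by rewrite (lt0r_neq0 a0) implybT.
by rewrite invfM mulrC.
Qed.
End Units.

(** * Logarithmic spirals *)

Section Spiral.
Variable R : realType.

Lemma carg_scale (a : R) (z : R[i]) : 0 < a -> carg (a%:C * z) = carg z.
Proof.
move=> a0; rewrite /carg normrM; case: z => x y.
rewrite !normc_def /= expr0n !mul0r subr0 !addr0 sqrtr_sqr gtr0_norm //.
by rewrite pmulr_rge0 // subr0 -mulf_div divff ?mul1r // lt0r_neq0.
Qed.

Lemma de_moivre (a : R) (k : nat) :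
  (cos a +i* sin a) ^+ k = cos (k%:R * a) +i* sin (k%:R * a).
Proof.
elim: k => [|k IH]; first by rewrite expr0 mul0r cos0 sin0.
rewrite exprS IH -natr1 mulrDl mul1r addrC cosD sinD.
by apply/eqP; rewrite eq_complex /=; apply/andP; split; apply/eqP; ring.
Qed.

(** Increasing the parameter by 1 along the spiral of modulus |z| and angle
    arg z is multiplication by z. *)
Lemma log_spiral_nat (z w : R[i]) (k : nat) : z != 0 ->
  log_spiral (complex.Re `|z|) (carg z) w k%:R = z ^+ k * w.
Proof.
move=> z0; rewrite /log_spiral [in RHS](carg_polar z0) exprMn de_moivre powR_mulrn.
  by rewrite normc_def /= rmorphXn.
by rewrite normc_def /= sqrtr_ge0.
Qed.
End Spiral.

(** * Periodic orbits *)

Lemma slope_cloudZ (R : realType) (K : fieldExtType rat)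
    (sigma_r : {rmorphism K -> R}) (sigma_c : {rmorphism K -> R[i]})
    (x : K) (s : 'rV[K]_3) :
  slope_cloud sigma_r sigma_c (x *: s) =
  slope sigma_r sigma_c x *: slope_cloud sigma_r sigma_c s.
Proof.
apply/rowP => i; rewrite !mxE /slope !rmorphM /= mulf_div.
by congr (_ / _); exact: rmorphM.
Qed.

Lemma eventually_geometric (F : nzRingType) (V : lmodType F) (u : nat -> V)
    (p : nat) (a : F) :
  (\forall t \near \oo, u (t + p)%N = a *: u t) ->
  \forall t \near \oo, forall k, u (t + k * p)%N = a ^+ k *: u t.
Proof.
move=> [M _ uM]; exists M => // t /= Mt; elim=> [|k IH].
  by rewrite mul0n addn0 scale1r.
rewrite mulSn addnCA addnC uM /= ?IH ?exprS ?scalerA //.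
exact: leq_trans (leq_addr _ _).
Qed.

Theorem proposition3p2 (R : realType) (K : fieldExtType rat)
    (dimK : \dim {:K} = 3%N) (sigK : has_signature R K 1 1)
    (sigma_r : {rmorphism K -> R}) (sigma_c : {rmorphism K -> R[i]})
    (sigma_cP : nonreal_embeddings sigma_c)
    (L : set K) (L_order : is_order L) (L_int : L `<=` @ring_of_integers K)
    (s : nat -> 'rV[K]_3) (s_state : forall t, is_state L sigma_r (s t))
    (p : nat) (p_gt0 : (1 <= p)%N)
    (lambda : K) (lambda_unit : integer_unit lambda)
    (lambda_gt0 : 0 < sigma_r lambda)
    (s_periodic : \forall t \near \oo, s (t + p)%N = lambda *: s t) :
  let zeta (t : nat) := slope_cloud sigma_r sigma_c (s t) in
  let mu := sigma_c lambda / (sigma_r lambda)%:C in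
  [/\ \forall t \near \oo, zeta (t + p)%N = mu *: zeta t,
      `|mu| = (sigma_r lambda `^ (- (3 / 2)))%:C,
      carg mu = carg (sigma_c lambda) &
      \forall t \near \oo, forall (k : nat) (i : 'I_3),
        zeta (t + k * p)%N 0 i =
        log_spiral (complex.Re `|mu|) (carg (sigma_c lambda)) (zeta t 0 i) k%:R].
Proof.
move=> zeta mu.
have zeta_p : \forall t \near \oo, zeta (t + p)%N = mu *: zeta t.
  by near=> t; rewrite -slope_cloudZ /zeta; congr slope_cloud; near: t.
have carg_mu : carg mu = carg (sigma_c lambda).
  by rewrite /mu mulrC -fmorphV carg_scale // invr_gt0.
have mu0 : mu != 0.
  have l0 : lambda != 0.
    by apply: contraTneq lambda_gt0 => ->; rewrite rmorph0 ltxx.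
  by rewrite mulf_neq0 ?invr_eq0 ?fmorph_eq0 //; exact/eqP/lt0r_neq0.
split=> //; first exact: (normc_slope_unit dimK (proj2 sigma_cP) lambda_unit lambda_gt0).
apply: filterS (eventually_geometric zeta_p) => t zeta_kp k i.
by rewrite -carg_mu log_spiral_nat // zeta_kp mxE.
Unshelve. all: by end_near. Qed.
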